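(* Let $Q$ be a connected quandle, $G = \mathrm{Inn}(Q)$, and let $c: Q\twoheadrightarrow R$ be a rigid quotient; use the isomorphism $\mathrm{Inn}(c)$ to identify $\mathrm{Inn}(R)$ with $G$. Fix $q\in Q$, let $H$ (resp. $K$) be the stabilizer in $G$ of $q$ (resp. of $c(q)$), and identify $Q$ with $H\backslash G$ and $R$ with $K\backslash G$, so that $c(Hg) = Kg$. Let $N\subseteq G = \mathrm{Inn}(H\backslash G)$ be a realizable kernel for the quandle $H\backslash G$, and let $c_N: (H\backslash G)/N \twoheadrightarrow (K\backslash G)/N$ be the surjective quandle homomorphism induced by $c$ on $N$-orbits, $c_N((Hg)\cdot N) = (Kg)\cdot N$. Then $c_N$ is a rigid quotient if and only if $N = N^{K\backslash G}$, where $N^{K\backslash G}$ is the smallest realizable kernel in $G = \mathrm{Inn}(K\backslash G)$, with respect to the quandle $K\backslash G$, containing $N$.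
   Context: A quandle is a set $Q$ with two binary operations $\rhd, \rhd^{-1}$ such that for all $x,y,z\in Q$: (i) $x\rhd x = x$; (ii) $(x\rhd y)\rhd^{-1} y = x = (x\rhd^{-1} y)\rhd y$; (iii) $(x\rhd y)\rhd z = (x\rhd z)\rhd (y\rhd z)$. A quandle homomorphism is a map preserving $\rhd$ (hence $\rhd^{-1}$). For $x\in Q$ the symmetry $S_x$ is the automorphism $S_x(y) = y\rhd x$. The inner automorphism group $\mathrm{Inn}(Q)$ is the group generated by all the $S_x$, regarded as acting on $Q$ on the right ($q\cdot S_x = q\rhd x$, $q\cdot(gh) = (q\cdot g)\cdot h$). $Q$ is connected if it has exactly one orbit under $\mathrm{Inn}(Q)$. A surjective quandle homomorphism $h:Q\to R$ induces a surjective group homomorphism $\mathrm{Inn}(h):\mathrm{Inn}(Q)\to\mathrm{Inn}(R)$ determined by $S_x\mapsto S_{h(x)}$. A rigid quotient is a surjective quandle homomorphism $h$ such that $\mathrm{Inn}(h)$ is an isomorphism. A realizable kernel in $\mathrm{Inn}(Q)$ is a subgroup of the form $\ker(\mathrm{Inn}(h))$ for some surjective quandle homomorphism $h:Q\to R$; this notion depends on the quandle $Q$, not only on the abstract group $\mathrm{Inn}(Q)$. The intersection of any family of realizable kernels in $\mathrm{Inn}(Q)$ is a realizable kernel, so for each normal subgroup $N$ of $\mathrm{Inn}(Q)$ there is a smallest realizable kernel $N^Q$ containing $N$. For a normal subgroup $N$ of $\mathrm{Inn}(Q)$, $Q/N$ is the set of orbits of $Q$ under $N$, with the quandle structure $(q\cdot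 N)\rhd(r\cdot N) = (q\rhd r)\cdot N$. If $Q$ is connected, $G=\mathrm{Inn}(Q)$, $q\in Q$ and $H$ is the stabilizer of $q$ in $G$, then $Q$ is identified with the set $H\backslash G$ of right cosets via $q\cdot g\leftrightarrow Hg$; setting $\eta = S_q\in G$, the operation becomes $Hg\rhd H\gamma = Hg\gamma^{-1}\eta\gamma$. A rigid quotient $c$ is equivariant for the $G$-actions, its target is connected, and the same identification is used for $R$ with the stabilizer $K$ of $c(q)$. *)

(* Defs.v *)
From HB Require Import structures.
From mathcomp Require Import all_boot.
From mathcomp Require Import boolp classical_sets.

Set Implicit Arguments.
Unset Strict Implicit.
Unset Printing Implicit Defensive.

Local Open Scope classical_set_scope.
Local Open Scope group_scope.

(* Quandles and groups may be infinite; the axioms of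
   [boolp] supply extensionality and make every type a [choiceType]. *)

Reserved Notation "x |> y" (at level 40, left associativity).
Reserved Notation "x |>^-1 y" (at level 40, left associativity).

HB.mixin Record isQuandle (Q : Type) := {
  rhd : Q -> Q -> Q;
  rhdV : Q -> Q -> Q;
  rhdxx : forall x, rhd x x = x;
  rhdK : forall x y, rhdV (rhd x y) y = x;
  rhdVK : forall x y, rhd (rhdV x y) y = x;
  rhdD : forall x y z, rhd (rhd x y) z = rhd (rhd x z) (rhd y z)
}.

#[short(type="quandleType")]
HB.structure Definition Quandle := { Q of isQuandle Q }.

Notation "x |> y" := (rhd x y) : group_scope.
Notation "x |>^-1 y" := (rhdV x y) : group_scope.

Lemma sval_inj (T : Type) (P : T -> Prop) : injective (@sval T P).
Proof. by move=> [x Px] [y Py] /= xy; apply: eq_exist. Qed.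

Record epi (Q R : quandleType) := Epi {
  epi_fun :> Q -> R;
  epi_morph : forall x y, epi_fun (x |> y) = epi_fun x |> epi_fun y;
  epi_surj : forall r, exists x, epi_fun x = r
}.

Section Groups.
Variable G : groupType.

Record is_subgroup (A : set G) : Prop := IsSubgroup {
  subgroup1 : A 1;
  subgroupM : forall x y, A x -> A y -> A (x * y);
  subgroupV : forall x, A x -> A x^-1
}.

Definition generated (A : set G) : set G := smallest is_subgroup A.

Lemma generated_subgroup A : is_subgroup (generated A).
Proof.
split=> [M [[]]//|x y Ax Ay M MA|x Ax M MA].
  by apply: (subgroupM MA.1); [exact: Ax|exact: Ay].
by apply: (subgroupV MA.1); exact: Ax.
Qed.

Record normal_subgroup := NormalSubgroup {
  nsub :> set G;
  nsub_group : is_subgroup nsub;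
  nsub_conj : forall n g, nsub n -> nsub (n ^ g)
}.

End Groups.

Section Permutations.
Variable X : Type.

Record permutation := Permutation {
  perm_fun :> X -> X;
  perm_inv : X -> X;
  perm_funK : cancel perm_fun perm_inv;
  perm_invK : cancel perm_inv perm_fun
}.

Lemma permutationP (f g : permutation) : (forall x, f x = g x) -> f = g.
Proof.
case: f g => [f f' fK f'K] [g g' gK g'K] /= fg.
have {}fg : f = g by apply: funext.
have fg' : f' = g' by apply: funext => x; rewrite -{1}(g'K x) -fg fK.
case: _ / fg gK g'K; case: _ / fg' => gK g'K.
by congr Permutation; exact: Prop_irrelevance.
Qed.

HB.instance Definition _ := gen_eqMixin permutation.
HB.instance Definition _ := gen_choiceMixin permutation.

Definition permutation1 : permutation :=
  @Permutation id id (fun=> erefl) (fun=> erefl).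

(* Permutations act on the right: [f * g] is "first f, then g". *)
Definition permutationM (f g : permutation) : permutation :=
  Permutation (can_comp (perm_funK g) (perm_funK f))
              (can_comp (perm_invK f) (perm_invK g)).

Definition permutationV (f : permutation) : permutation :=
  Permutation (perm_invK f) (perm_funK f).

Lemma permutationMA : associative permutationM.
Proof. by move=> f g h; apply: permutationP. Qed.

Lemma permutation1M : left_id permutation1 permutationM.
Proof. by move=> f; apply: permutationP. Qed.

Lemma permutationM1 : right_id permutation1 permutationM.
Proof. by move=> f; apply: permutationP. Qed.

Lemma permutationVM : left_inverse permutation1 permutationV permutationM.
Proof. by move=> f; apply: permutationP => x /=; rewrite perm_invK. Qed.

Lemma permutationMV : right_inverse permutation1 permutationV permutationM.
Proof. by move=> f; apply: permutationP => x /=; rewrite perm_funK. Qed.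

HB.instance Definition _ := isGroup.Build permutation permutationMA
  permutation1M permutationM1 permutationVM permutationMV.

End Permutations.

Section Inn.
Variable Q : quandleType.

Definition symmetry_perm (x : Q) : permutation Q :=
  @Permutation Q (fun y => y |> x) (fun y => y |>^-1 x)
    (fun y => rhdK y x) (fun y => rhdVK y x).

Definition Inn_set : set (permutation Q) := generated (range symmetry_perm).

Definition Inn : Type := {f : permutation Q | Inn_set f}.

HB.instance Definition _ := gen_eqMixin Inn.
HB.instance Definition _ := gen_choiceMixin Inn.

Definition Inn_val (g : Inn) : permutation Q := sval g.

Definition toInn (f : permutation Q) (fI : Inn_set f) : Inn :=
  exist _ f fI.

Lemma Inn_valP (g : Inn) : Inn_set (Inn_val g).
Proof. exact: svalP g. Qed.

Definition act (x : Q) (g : Inn) : Q := Inn_val g x.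

Lemma actP (g h : Inn) : (forall x, act x g = act x h) -> g = h.
Proof.
move=> gh; apply: sval_inj; apply: permutationP => x; exact: gh.
Qed.

Definition Inn1 : Inn := toInn (subgroup1 (generated_subgroup _)).
Definition InnM (g h : Inn) : Inn :=
  toInn (subgroupM (generated_subgroup _) (Inn_valP g) (Inn_valP h)).
Definition InnV (g : Inn) : Inn :=
  toInn (subgroupV (generated_subgroup _) (Inn_valP g)).

Lemma InnMA : associative InnM.
Proof. by move=> f g h; apply: actP. Qed.

Lemma Inn1M : left_id Inn1 InnM.
Proof. by move=> f; apply: actP. Qed.

Lemma InnM1 : right_id Inn1 InnM.
Proof. by move=> f; apply: actP. Qed.

Lemma InnVM : left_inverse Inn1 InnV InnM.
Proof.
by move=> f; apply: actP => x; rewrite /act /= (perm_invK (Inn_val f)).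
Qed.

Lemma InnMV : right_inverse Inn1 InnV InnM.
Proof.
by move=> f; apply: actP => x; rewrite /act /= (perm_funK (Inn_val f)).
Qed.

HB.instance Definition _ := isGroup.Build Inn InnMA Inn1M InnM1 InnVM InnMV.

Lemma symmetry_perm_Inn x : Inn_set (symmetry_perm x).
Proof. by apply: sub_gen_smallest; exists x. Qed.

Definition symm (x : Q) : Inn := toInn (symmetry_perm_Inn x).

Lemma actS x y : act y (symm x) = y |> x. Proof. by []. Qed.
Lemma act1 x : act x 1 = x. Proof. by []. Qed.
Lemma actM x g h : act x (g * h) = act (act x g) h. Proof. by []. Qed.
Lemma actK g : cancel (act^~ g) (act^~ g^-1).
Proof. by move=> x; rewrite -actM mulgV act1. Qed.
Lemma actKV g : cancel (act^~ g^-1) (act^~ g).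
Proof. by move=> x; rewrite -actM mulVg act1. Qed.

Lemma Inn_ind (P : Inn -> Prop) :
  P 1 -> (forall g h, P g -> P h -> P (g * h)) ->
  (forall g, P g -> P g^-1) -> (forall x, P (symm x)) -> forall g, P g.
Proof.
move=> P1 PM PV PS g.
pose A : set (permutation Q) := [set f | exists fI : Inn_set f, P (toInn fI)].
have Asub : is_subgroup A.
  split=> [|f h [fI Pf] [hI Ph]|f [fI Pf]].
  - by exists (Inn_valP 1); rewrite (_ : toInn _ = 1) //; apply: actP.
  - exists (Inn_valP (toInn fI * toInn hI)).
    by rewrite (_ : toInn _ = toInn fI * toInn hI); [exact: PM|exact: actP].
  - exists (Inn_valP (toInn fI)^-1).
    by rewrite (_ : toInn _ = (toInn fI)^-1); [exact: PV|exact: actP].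
have AS : range symmetry_perm `<=` A.
  by move=> _ [x _ <-]; exists (symmetry_perm_Inn x); exact: PS.
have [gI Pg] := smallest_sub Asub AS (Inn_valP g).
by rewrite (_ : g = toInn gI) //; exact: actP.
Qed.

Lemma act_rhd x y g : act (x |> y) g = act x g |> act y g.
Proof.
elim/Inn_ind: g x y => // [g h IHg IHh x y|g IHg x y|z x y].
- by rewrite !actM IHg IHh.
- by apply: (can_inj (actK g)); rewrite IHg !actKV.
- by rewrite !actS rhdD.
Qed.

Lemma symm_act x g : symm (act x g) = symm x ^ g.
Proof.
apply: actP => y; rewrite conjgE !actM !actS.
by rewrite act_rhd actKV.
Qed.

Definition Inn_orbit (x : Q) : set Q := range (act x).

Definition connected : Prop := exists O, range Inn_orbit = [set O].

Lemma connectedP : connected -> forall x y, exists g, act x g = y.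
Proof.
case=> O QO x y.
have QO1 z : Inn_orbit z = O by have : range Inn_orbit (Inn_orbit z);
  [exists z|rewrite QO].
have : Inn_orbit x y by rewrite QO1 -(QO1 y); exists 1.
by case=> g _ <-; exists g.
Qed.

End Inn.

Section InnMap.
Variables (Q R : quandleType) (h : epi Q R).

Lemma Inn_map_ex (g : Inn Q) :
  exists g' : Inn R, forall x, act (h x) g' = h (act x g).
Proof.
elim/Inn_ind: g => [|g1 g2 [f1 H1] [f2 H2]|g [f H]|x].
- by exists 1.
- by exists (f1 * f2) => x; rewrite !actM H1 H2.
- by exists f^-1 => x; apply: (can_inj (actK f)); rewrite /= actKV H actKV.
- by exists (symm (h x)) => y; rewrite !actS epi_morph.
Qed.

(* The map Inn(h), pinned down by equivariance ([Inn_mapE]); it is a group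
   homomorphism sending [symm x] to [symm (h x)] ([Inn_map_S]). *)
Definition Inn_map (g : Inn Q) : Inn R := sval (cid (Inn_map_ex g)).

Lemma Inn_mapE g x : act (h x) (Inn_map g) = h (act x g).
Proof. exact: (svalP (cid (Inn_map_ex g))). Qed.

Lemma Inn_map_uniq g g' :
  (forall x, act (h x) g' = h (act x g)) -> Inn_map g = g'.
Proof.
by move=> H; apply: actP => r; have [x <-] := epi_surj h r; rewrite Inn_mapE.
Qed.

Lemma Inn_mapM : {morph Inn_map : f g / f * g}.
Proof. by move=> f g; apply: Inn_map_uniq => x; rewrite !actM !Inn_mapE. Qed.

HB.instance Definition _ :=
  isMultiplicative.Build (Inn Q) (Inn R) Inn_map Inn_mapM.

Lemma Inn_map1 : Inn_map 1 = 1.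
Proof. exact: Inn_map_uniq. Qed.

Lemma Inn_mapV g : Inn_map g^-1 = (Inn_map g)^-1.
Proof. by apply: (mulIg (Inn_map g)); rewrite -Inn_mapM !mulVg Inn_map1. Qed.

Lemma Inn_map_S x : Inn_map (symm x) = symm (h x).
Proof. by apply: Inn_map_uniq => y; rewrite !actS epi_morph. Qed.

Lemma Inn_map_surj g' : exists g, Inn_map g = g'.
Proof.
elim/Inn_ind: g' => [|g1 g2 [f1 <-] [f2 <-]|g [f <-]|r].
- by exists 1; rewrite Inn_map1.
- by exists (f1 * f2); rewrite Inn_mapM.
- by exists f^-1; rewrite Inn_mapV.
- by have [x <-] := epi_surj h r; exists (symm x); rewrite Inn_map_S.
Qed.

Definition rigid_quotient : Prop := bijective Inn_map.

Lemma inj_rigid : injective h -> rigid_quotient.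
Proof.
move=> hI; pose f g' := sval (cid (Inn_map_surj g')).
have fK : cancel f Inn_map by move=> g'; exact: svalP (cid (Inn_map_surj g')).
exists f => // g; apply: actP => x; apply: hI.
by rewrite -!Inn_mapE fK.
Qed.

End InnMap.

(* [innIso G X] records a reading of the equality "G = Inn(X)". *)
Record innIso (G : groupType) (X : quandleType) := InnIso {
  iso_fun :> G -> Inn X;
  isoM : {morph iso_fun : f g / f * g};
  iso_bij : bijective iso_fun
}.

Section ViaIso.
Variables (G : groupType) (X : quandleType) (i : innIso G X).

Lemma iso1 : i 1 = 1.
Proof. by apply: (mulgI (i 1)); rewrite -isoM !mulg1. Qed.

Lemma isoV g : i g^-1 = (i g)^-1.
Proof. by apply: (mulIg (i g)); rewrite -isoM !mulVg iso1. Qed.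

Lemma isoJ f g : i (f ^ g) = i f ^ i g.
Proof. by rewrite !conjgE !isoM isoV. Qed.

Definition gact (x : X) (g : G) : X := act x (i g).

Lemma gactM x f g : gact x (f * g) = gact (gact x f) g.
Proof. by rewrite /gact isoM. Qed.
Lemma gact1 x : gact x 1 = x.
Proof. by rewrite /gact iso1. Qed.
Lemma gactK g : cancel (gact^~ g) (gact^~ g^-1).
Proof. by move=> x; rewrite -gactM mulgV gact1. Qed.
Lemma gactKV g : cancel (gact^~ g^-1) (gact^~ g).
Proof. by move=> x; rewrite -gactM mulVg gact1. Qed.

Definition stabilizer (x : X) : set G := [set g | gact x g = x].

Definition realizable_kernel (N : set G) : Prop :=
  exists (Y : quandleType) (h : epi X Y), N = [set g | Inn_map h (i g) = 1].

(* The smallest realizable kernel N^X containing N; see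
   [realizable_hull_realizable] below. *)
Definition realizable_hull (N : set G) : set G := smallest realizable_kernel N.

Variable N : normal_subgroup G.

Definition Norbit (x : X) : set X := [set gact x n | n in N].

(* X/N, the set of N-orbits.  The product of two orbits is their elementwise
   product, which is again an orbit by [Norbit_rhd] and [Norbit_rhdV]. *)
Definition orbits : Type := {A : set X | range Norbit A}.

Definition cls (x : X) : orbits := exist _ (Norbit x) (imageT Norbit x).

Lemma orbitsP (A : orbits) : exists x, A = cls x.
Proof.
by have [x _ xA] := svalP A; exists x; apply: sval_inj.
Qed.

Lemma Norbit_id x : Norbit x x.
Proof. by exists 1; [exact: subgroup1 (nsub_group N)|rewrite gact1]. Qed.

Lemma Norbit_eq x n : nsub N n -> Norbit (gact x n) = Norbit x.
Proof.
have [N1 NM NV] := nsub_group N.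
move=> Nn; apply/seteqP; split=> _ [m Nm <-].
  by exists (n * m); [exact: NM|rewrite gactM].
by exists (n^-1 * m); [apply: NM => //; exact: NV|rewrite gactM gactK].
Qed.

Lemma Norbit_twist (f : X -> G) :
  (forall y m, f (gact y m) = f y ^ m) -> forall x y,
  [set gact a (f b) | a in Norbit x & b in Norbit y] = Norbit (gact x (f y)).
Proof.
have [N1 NM NV] := nsub_group N.
move=> fJ x y; apply/seteqP; split.
  move=> _ [_ [n Nn <-] [_ [m Nm <-] <-]].
  exists ((n ^ f y) * ((m^-1) ^ f y * m)).
    by apply: (NM); [exact: nsub_conj|apply: (NM) => //; apply: nsub_conj; exact: NV].
  by rewrite fJ -!gactM !conjgE !mulgA; rewrite mulgV mul1g mulgK.
move=> _ [n Nn <-].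
exists (gact x (n ^ (f y)^-1)).
  by exists (n ^ (f y)^-1) => //; exact: nsub_conj.
exists y; first exact: Norbit_id.
by rewrite -!gactM !conjgE invgK !mulgA mulgVK.
Qed.

Lemma Norbit_rhd x y :
  [set a |> b | a in Norbit x & b in Norbit y] = Norbit (x |> y).
Proof.
have [j ij ji] := iso_bij i.
have rhdE u v : u |> v = gact u (j (symm v)) by rewrite /gact ji.
rewrite rhdE -(Norbit_twist (f := fun v => j (symm v))).
  by congr (image2 _ _ _); apply/funext => u; apply/funext => v; exact: rhdE.
by move=> u m; apply: (can_inj ij); rewrite isoJ !ji symm_act.
Qed.

Lemma Norbit_rhdV x y :
  [set a |>^-1 b | a in Norbit x & b in Norbit y] = Norbit (x |>^-1 y).
Proof.
have [j ij ji] := iso_bij i.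
have rhdE u v : u |>^-1 v = gact u (j (symm v)^-1) by rewrite /gact ji.
rewrite rhdE -(Norbit_twist (f := fun v => j (symm v)^-1)).
  by congr (image2 _ _ _); apply/funext => u; apply/funext => v; exact: rhdE.
by move=> u m; apply: (can_inj ij); rewrite isoJ !ji symm_act conjVg.
Qed.

Lemma orbits_rhd_subproof (A B : orbits) :
  range Norbit [set a |> b | a in sval A & b in sval B].
Proof.
have [[x ->] [y ->]] := (orbitsP A, orbitsP B).
by exists (x |> y); rewrite // -Norbit_rhd.
Qed.

Lemma orbits_rhdV_subproof (A B : orbits) :
  range Norbit [set a |>^-1 b | a in sval A & b in sval B].
Proof.
have [[x ->] [y ->]] := (orbitsP A, orbitsP B).
by exists (x |>^-1 y); rewrite // -Norbit_rhdV.
Qed.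

Definition orbits_rhd (A B : orbits) : orbits :=
  exist _ _ (orbits_rhd_subproof A B).

Definition orbits_rhdV (A B : orbits) : orbits :=
  exist _ _ (orbits_rhdV_subproof A B).

Lemma orbits_rhdE x y : orbits_rhd (cls x) (cls y) = cls (x |> y).
Proof. by apply: sval_inj; exact: Norbit_rhd. Qed.

Lemma orbits_rhdVE x y : orbits_rhdV (cls x) (cls y) = cls (x |>^-1 y).
Proof. by apply: sval_inj; exact: Norbit_rhdV. Qed.

Lemma orbits_rhdxx A : orbits_rhd A A = A.
Proof. by have [x ->] := orbitsP A; rewrite orbits_rhdE rhdxx. Qed.

Lemma orbits_rhdK A B : orbits_rhdV (orbits_rhd A B) B = A.
Proof.
have [[x ->] [y ->]] := (orbitsP A, orbitsP B).
by rewrite orbits_rhdE orbits_rhdVE rhdK.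
Qed.

Lemma orbits_rhdVK A B : orbits_rhd (orbits_rhdV A B) B = A.
Proof.
have [[x ->] [y ->]] := (orbitsP A, orbitsP B).
by rewrite orbits_rhdVE orbits_rhdE rhdVK.
Qed.

Lemma orbits_rhdD A B C : orbits_rhd (orbits_rhd A B) C =
  orbits_rhd (orbits_rhd A C) (orbits_rhd B C).
Proof.
have [[x ->] [[y ->] [z ->]]] := (orbitsP A, (orbitsP B, orbitsP C)).
by rewrite !orbits_rhdE rhdD.
Qed.

HB.instance Definition _ := isQuandle.Build orbits
  orbits_rhdxx orbits_rhdK orbits_rhdVK orbits_rhdD.

Lemma cls_morph x y : cls (x |> y) = cls x |> cls y.
Proof. by rewrite -orbits_rhdE. Qed.

Lemma cls_surj (A : orbits) : exists x, cls x = A.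
Proof. by have [x ->] := orbitsP A; exists x. Qed.

Definition orbits_epi : epi X orbits := Epi cls_morph cls_surj.

End ViaIso.

Section Hull.
Variables (G : groupType) (X : quandleType) (i : innIso G X).

Lemma realizable_normal N : realizable_kernel i N ->
  is_subgroup N /\ forall n g, N n -> N (n ^ g).
Proof.
case=> Y [h ->]; split; first split=> /=.
- by rewrite iso1 Inn_map1.
- by move=> x y Hx Hy; rewrite isoM Inn_mapM Hx Hy mulg1.
- by move=> x Hx; rewrite isoV Inn_mapV Hx invg1.
- by move=> n g /= Hn; rewrite isoJ conjgE !Inn_mapM Inn_mapV Hn mul1g mulVg.
Qed.

Lemma realizable_bigcap (F : set (set G)) :
  (forall M, F M -> realizable_kernel i M) ->
  realizable_kernel i (\bigcap_(M in F) M).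
Proof.
move=> FR; set M := (X in realizable_kernel _ X).
have Msub : is_subgroup M.
  split=> [A FA|x y Mx My A FA|x Mx A FA];
    have [[A1 AM AV] _] := realizable_normal (FR _ FA); first exact: A1.
  - by apply: AM; [exact: Mx|exact: My].
  - by apply: AV; exact: Mx.
have Mconj n g : M n -> M (n ^ g).
  by move=> Mn A FA; apply: (realizable_normal (FR _ FA)).2; exact: Mn.
pose N := NormalSubgroup Msub Mconj.
exists (orbits i N), (orbits_epi i N); apply/seteqP; split=> g /=.
  move=> Mg; apply: Inn_map_uniq => x; rewrite act1; apply: sval_inj.
  exact/esym/(@Norbit_eq _ _ i N).
move=> g1 A FA; have [Y [h Ah]] := FR _ FA; rewrite Ah /=.
apply: Inn_map_uniq => x; rewrite act1 -/(gact i x g).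
have : cls i N (gact i x g) = cls i N x.
  by have := Inn_mapE (orbits_epi i N) (i g) x; rewrite g1 act1.
move=> /(congr1 sval) /= xgx.
have [n Nn <-] : Norbit i N x (gact i x g) by rewrite -xgx; exact: Norbit_id.
have := Nn A FA; rewrite Ah /= => n1.
by rewrite -Inn_mapE n1.
Qed.

Lemma realizable_hull_realizable N : realizable_kernel i (realizable_hull i N).
Proof. by apply: realizable_bigcap => M []. Qed.

Lemma realizable_hull_sub N : N `<=` realizable_hull i N.
Proof. exact: sub_gen_smallest. Qed.

Lemma realizable_hull_min N M :
  realizable_kernel i M -> N `<=` M -> realizable_hull i N `<=` M.
Proof. exact: smallest_sub. Qed.

End Hull.

(* The map on N-orbits induced by a G-equivariant surjective homomorphism;
   the direct image of the orbit of [x] is the orbit of [h x]. *)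
Section OrbitMap.
Variables (G : groupType) (X Y : quandleType).
Variables (i : innIso G X) (j : innIso G Y) (h : epi X Y).
Hypothesis h_eq : forall x g, h (gact i x g) = gact j (h x) g.
Variable N : normal_subgroup G.

Lemma image_Norbit x : h @` Norbit i N x = Norbit j N (h x).
Proof.
apply/seteqP; split=> [_ [_ [n Nn <-] <-]|_ [n Nn <-]].
  by exists n => //; rewrite h_eq.
by exists (gact i x n); [exists n|rewrite h_eq].
Qed.

Lemma orbit_map_subproof (A : orbits i N) :
  range (Norbit j N) (h @` sval A).
Proof. by have [x ->] := orbitsP A; exists (h x); rewrite // image_Norbit. Qed.

Definition orbit_map_fun (A : orbits i N) : orbits j N :=
  exist _ _ (orbit_map_subproof A).

Lemma orbit_mapE x : orbit_map_fun (cls i N x) = cls j N (h x).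
Proof. by apply: sval_inj; exact: image_Norbit. Qed.

Lemma orbit_map_morph A B :
  orbit_map_fun (A |> B) = orbit_map_fun A |> orbit_map_fun B.
Proof.
have [[x ->] [y ->]] := (orbitsP A, orbitsP B).
by rewrite -cls_morph !orbit_mapE epi_morph cls_morph.
Qed.

Lemma orbit_map_surj B : exists A, orbit_map_fun A = B.
Proof.
have [y ->] := orbitsP B; have [x <-] := epi_surj h y.
by exists (cls i N x); rewrite orbit_mapE.
Qed.

Definition orbit_map : epi (orbits i N) (orbits j N) :=
  Epi orbit_map_morph orbit_map_surj.

End OrbitMap.

Record coset_data (G : groupType) := CosetData {
  csub : set G;
  csub_group : is_subgroup csub;
  ceta : G;
  ceta_in : csub ceta;
  ceta_cent : forall h, csub h -> h * ceta = ceta * h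
}.

(* The quandle H\G of right cosets, with H = csub D and eta = ceta D; the
   product of two cosets is given by a set of products, which is the coset
   Hg gamma^-1 eta gamma by [coset_rhdE]. *)
Section Cosets.
Variables (G : groupType) (D : coset_data G).
Local Notation H := (csub D).
Local Notation eta := (ceta D).

Definition coset (g : G) : set G := [set h * g | h in H].

Definition cosets : Type := {A : set G | range coset A}.

Definition ccls (g : G) : cosets := exist _ (coset g) (imageT coset g).

Lemma cosetsP (A : cosets) : exists g, A = ccls g.
Proof. by have [g _ gA] := svalP A; exists g; apply: sval_inj. Qed.

Lemma coset_id g : coset g g.
Proof. by exists 1; [exact: subgroup1 (csub_group D)|rewrite mul1g]. Qed.

Lemma coset_eq h g : H h -> coset (h * g) = coset g.
Proof.
have [H1 HM HV] := csub_group D.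
move=> Hh; apply/seteqP; split=> _ [k Hk <-].
  by exists (k * h); [exact: HM|rewrite mulgA].
by exists (k * h^-1); [apply: HM => //; exact: HV|rewrite mulgA mulgVK].
Qed.

Lemma coset_twist (e : G) : (forall h, H h -> h * e = e * h) -> forall g r,
  [set a * b^-1 * e * b | a in coset g & b in coset r] =
  coset (g * r^-1 * e * r).
Proof.
move=> eC g r; apply/seteqP; split.
  move=> _ [_ [h Hh <-] [_ [k Hk <-] <-]].
  exists h => //; rewrite invgM !mulgA; congr (_ * r).
  by rewrite -!mulgA -eC // !mulgA mulgVK.
move=> _ [h Hh <-]; exists (h * g); first by exists h.
by exists r; [exact: coset_id|rewrite !mulgA].
Qed.

Lemma coset_rhd g r :
  [set a * b^-1 * eta * b | a in coset g & b in coset r] =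
  coset (g * r^-1 * eta * r).
Proof. exact/coset_twist/ceta_cent. Qed.

Lemma coset_rhdV g r :
  [set a * b^-1 * eta^-1 * b | a in coset g & b in coset r] =
  coset (g * r^-1 * eta^-1 * r).
Proof.
apply: coset_twist => h /ceta_cent hE.
by apply: (mulgI eta); rewrite !mulgA -hE mulgK mulgV mul1g.
Qed.

Lemma cosets_rhd_subproof (A B : cosets) :
  range coset [set a * b^-1 * eta * b | a in sval A & b in sval B].
Proof.
have [[g ->] [r ->]] := (cosetsP A, cosetsP B).
by exists (g * r^-1 * eta * r); rewrite // -coset_rhd.
Qed.

Lemma cosets_rhdV_subproof (A B : cosets) :
  range coset [set a * b^-1 * eta^-1 * b | a in sval A & b in sval B].
Proof.
have [[g ->] [r ->]] := (cosetsP A, cosetsP B).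
by exists (g * r^-1 * eta^-1 * r); rewrite // -coset_rhdV.
Qed.

Definition cosets_rhd (A B : cosets) : cosets :=
  exist _ _ (cosets_rhd_subproof A B).

Definition cosets_rhdV (A B : cosets) : cosets :=
  exist _ _ (cosets_rhdV_subproof A B).

Lemma cosets_rhdE g r :
  cosets_rhd (ccls g) (ccls r) = ccls (g * r^-1 * eta * r).
Proof. by apply: sval_inj; exact: coset_rhd. Qed.

Lemma cosets_rhdVE g r :
  cosets_rhdV (ccls g) (ccls r) = ccls (g * r^-1 * eta^-1 * r).
Proof. by apply: sval_inj; exact: coset_rhdV. Qed.

Lemma cosets_rhdxx A : cosets_rhd A A = A.
Proof.
have [g ->] := cosetsP A; rewrite cosets_rhdE mulgV mul1g.
by apply: sval_inj; apply: coset_eq; exact: ceta_in.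
Qed.

Lemma cosets_rhdK A B : cosets_rhdV (cosets_rhd A B) B = A.
Proof.
have [[x ->] [y ->]] := (cosetsP A, cosetsP B).
by rewrite cosets_rhdE cosets_rhdVE ?mulgA !(mulgK, mulgVK).
Qed.

Lemma cosets_rhdVK A B : cosets_rhd (cosets_rhdV A B) B = A.
Proof.
have [[x ->] [y ->]] := (cosetsP A, cosetsP B).
by rewrite cosets_rhdVE cosets_rhdE ?mulgA !(mulgK, mulgVK).
Qed.

Lemma cosets_rhdD A B C : cosets_rhd (cosets_rhd A B) C =
  cosets_rhd (cosets_rhd A C) (cosets_rhd B C).
Proof.
have [[x ->] [[y ->] [z ->]]] := (cosetsP A, (cosetsP B, cosetsP C)).
by rewrite !cosets_rhdE !invgM !invgK !mulgA !(mulgK, mulgVK).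
Qed.

HB.instance Definition _ := isQuandle.Build cosets
  cosets_rhdxx cosets_rhdK cosets_rhdVK cosets_rhdD.

Lemma coset_rhdE g r : ccls g |> ccls r = ccls (g * r^-1 * eta * r).
Proof. exact: cosets_rhdE. Qed.

End Cosets.

(* The projection Hg |-> Kg, for H contained in K. *)
Section CosetMap.
Variables (G : groupType) (D E : coset_data G).
Hypothesis DE : csub D `<=` csub E.
Hypothesis eta_eq : ceta D = ceta E.

Lemma coset_map_coset g :
  [set k * a | k in csub E & a in coset D g] = coset E g.
Proof.
apply/seteqP; split=> [_ [k Kk [_ [h Hh <-] <-]]|_ [k Kk <-]].
  by exists (k * h); [apply: (subgroupM (csub_group E)) => //; exact: DE
                     |rewrite mulgA].
by exists k => //; exists g => //; exact: coset_id.
Qed.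

Lemma coset_map_subproof (A : cosets D) :
  range (coset E) [set k * a | k in csub E & a in sval A].
Proof. by have [g ->] := cosetsP A; exists g; rewrite // -coset_map_coset. Qed.

Definition coset_map_fun (A : cosets D) : cosets E :=
  exist _ _ (coset_map_subproof A).

Lemma coset_mapE g : coset_map_fun (ccls D g) = ccls E g.
Proof. by apply: sval_inj; exact: coset_map_coset. Qed.

Lemma coset_map_morph A B :
  coset_map_fun (A |> B) = coset_map_fun A |> coset_map_fun B.
Proof.
have [[x ->] [y ->]] := (cosetsP A, cosetsP B).
by rewrite coset_rhdE !coset_mapE coset_rhdE eta_eq.
Qed.

Lemma coset_map_surj B : exists A, coset_map_fun A = B.
Proof. by have [g ->] := cosetsP B; exists (ccls D g); rewrite coset_mapE. Qed.

Definition coset_map : epi (cosets D) (cosets E) :=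
  Epi coset_map_morph coset_map_surj.

End CosetMap.

(* The identification of a connected quandle X with (stabilizer of x)\G,
   where G = Inn(X) and eta is [symm x] seen in G. *)
Section Presentation.
Variables (G : groupType) (X : quandleType) (i : innIso G X).
Hypothesis connX : connected X.
Variables (x : X) (eta : G).
Hypothesis eta_symm : i eta = symm x.

Lemma stabilizer_subgroup : is_subgroup (stabilizer i x).
Proof.
split=> [|g h gx hx|g gx]; rewrite /stabilizer /=.
- exact: gact1.
- by rewrite gactM gx hx.
- by rewrite -{1}gx gactK.
Qed.

Lemma eta_stabilizer : stabilizer i x eta.
Proof. by rewrite /stabilizer /= /gact eta_symm actS rhdxx. Qed.

Lemma eta_central h : stabilizer i x h -> h * eta = eta * h.
Proof.
move=> hx; have hS : eta ^ h = eta.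
  apply: (bij_inj (iso_bij i)).
  by rewrite isoJ eta_symm -symm_act -/(gact i x h) hx.
by rewrite -{1}hS conjgE !mulgA mulgV mul1g.
Qed.

Definition stab_data : coset_data G :=
  CosetData stabilizer_subgroup eta_stabilizer eta_central.

Lemma gact_trans y : exists g, gact i x g = y.
Proof.
have [f fy] := connectedP connX x y; have [j ij ji] := iso_bij i.
by exists (j f); rewrite /gact ji.
Qed.

Lemma coset_of_point_subproof (y : X) :
  range (coset stab_data) [set g | gact i x g = y].
Proof.
have [g gy] := gact_trans y; exists g => //; apply/seteqP; split=> [_ [h hx <-]|f fy] /=.
  by rewrite gactM hx.
by exists (f * g^-1); rewrite /= ?mulgVK // /stabilizer /= gactM fy -gy gactK.
Qed.

Definition coset_of_point_fun (y : X) : cosets stab_data :=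
  exist _ _ (coset_of_point_subproof y).

Lemma coset_of_pointE g : coset_of_point_fun (gact i x g) = ccls stab_data g.
Proof.
apply: sval_inj; apply/seteqP; split=> [f fg|_ [h hx <-]] /=.
  exists (f * g^-1); rewrite /= ?mulgVK // /stabilizer /=.
  by move: fg => /= fg; rewrite gactM fg gactK.
by rewrite gactM hx.
Qed.

Lemma coset_of_point_morph y z : coset_of_point_fun (y |> z) =
  coset_of_point_fun y |> coset_of_point_fun z.
Proof.
have [[g <-] [r <-]] := (gact_trans y, gact_trans z).
rewrite !coset_of_pointE coset_rhdE /=.
have -> : gact i x g |> gact i x r = gact i x (g * r^-1 * eta * r).
  rewrite -!mulgA -conjgE gactM /gact isoJ eta_symm -symm_act.
  by rewrite actS.
by rewrite coset_of_pointE.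
Qed.

Lemma coset_of_point_surj A : exists y, coset_of_point_fun y = A.
Proof.
by have [g ->] := cosetsP A; exists (gact i x g); rewrite coset_of_pointE.
Qed.

(* The isomorphism x.g |-> Hg. *)
Definition coset_of_point : epi X (cosets stab_data) :=
  Epi coset_of_point_morph coset_of_point_surj.

Lemma coset_of_point_inj : injective coset_of_point.
Proof.
move=> y z; have [[g <-] [r <-]] := (gact_trans y, gact_trans z).
move=> /(congr1 sval) /seteqP[/(_ g) + _] /=.
exact.
Qed.

(* The resulting identification of G = Inn(X) with Inn(H\G): the element [g]
   acts by right translation, see [gact_coset]. *)
Definition coset_iso : innIso G (cosets stab_data).
Proof.
apply: (@InnIso G (cosets stab_data) (fun g => Inn_map coset_of_point (i g))).
  by move=> f g; rewrite isoM Inn_mapM.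
exact: (bij_comp (inj_rigid coset_of_point_inj) (iso_bij i)).
Defined.

Lemma gact_coset g f :
  gact coset_iso (ccls stab_data g) f = ccls stab_data (g * f).
Proof.
rewrite -!coset_of_pointE /gact /= (Inn_mapE coset_of_point).
by rewrite -/(gact i _ f) -gactM.
Qed.

End Presentation.

Lemma epi_connected (Q R : quandleType) (c : epi Q R) :
  connected Q -> connected R.
Proof.
move=> connQ; have [O QO] := connQ.
have [q _ _] : range (@Inn_orbit Q) O by rewrite QO.
exists setT; apply/seteqP; split=> [_ [r _ <-]|_ ->] /=; last first.
  exists (c q) => //; apply/seteqP; split=> // r _.
  have [y <-] := epi_surj c r; have [g <-] := connectedP connQ q y.
  by exists (Inn_map c g) => //; rewrite Inn_mapE.
apply/seteqP; split=> // s _.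
have [[x <-] [y <-]] := (epi_surj c r, epi_surj c s).
have [g <-] := connectedP connQ x y.
by exists (Inn_map c g) => //; rewrite Inn_mapE.
Qed.

Definition id_iso (Q : quandleType) : innIso (Inn Q) Q :=
  @InnIso (Inn Q) Q id (fun _ _ => erefl) (inv_bij (frefl id)).

Definition rigid_iso (Q R : quandleType) (c : epi Q R)
    (c_rigid : rigid_quotient c) : innIso (Inn Q) R :=
  InnIso (Inn_mapM c) c_rigid.

Section RigidCosets.
Variables (Q R : quandleType) (connQ : connected Q) (c : epi Q R).
Variables (c_rigid : rigid_quotient c) (q : Q).

(* H, K and eta = symm q = symm (c q), all inside G = Inn(Q). *)
Definition H_data : coset_data (Inn Q) :=
  @stab_data _ _ (id_iso Q) q (symm q) erefl.

Definition K_data : coset_data (Inn Q) :=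
  @stab_data _ _ (rigid_iso c_rigid) (c q) (symm q) (Inn_map_S c q).

(* G = Inn(H\G) and G = Inn(K\G). *)
Definition H_iso : innIso (Inn Q) (cosets H_data) :=
  coset_iso connQ _.

Definition K_iso : innIso (Inn Q) (cosets K_data) :=
  coset_iso (epi_connected c connQ) _.

Lemma sub_HK : csub H_data `<=` csub K_data.
Proof.
by move=> g gq; rewrite /= /stabilizer /= /gact /= Inn_mapE; congr (c _).
Qed.

Definition c_cosets : epi (cosets H_data) (cosets K_data) :=
  coset_map sub_HK erefl.

Lemma c_cosetsE g : c_cosets (ccls H_data g) = ccls K_data g.
Proof. exact: coset_mapE. Qed.

(* [c_cosets] is [c] seen through the identifications of Q and R. *)
Lemma c_cosets_of_point x :
  c_cosets (coset_of_point connQ (erefl : id_iso Q (symm q) = symm q) x) =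
  coset_of_point (epi_connected c connQ)
    (Inn_map_S c q : rigid_iso c_rigid (symm q) = symm (c q)) (c x).
Proof.
have [g <-] := gact_trans (id_iso Q) connQ q x.
rewrite /= coset_of_pointE coset_mapE.
have -> : c (gact (id_iso Q) q g) = gact (rigid_iso c_rigid) (c q) g.
  by rewrite /gact /= Inn_mapE.
by rewrite coset_of_pointE.
Qed.

Lemma c_cosets_equivariant A g :
  c_cosets (gact H_iso A g) = gact K_iso (c_cosets A) g.
Proof.
have [f ->] := cosetsP A.
by rewrite c_cosetsE !gact_coset c_cosetsE.
Qed.

Variable N : normal_subgroup (Inn Q).

(* c_N : (H\G)/N -> (K\G)/N *)
Definition c_orbits : epi (orbits H_iso N) (orbits K_iso N) :=
  orbit_map c_cosets_equivariant N.

Lemma c_orbitsE g :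
  c_orbits (cls H_iso N (ccls H_data g)) = cls K_iso N (ccls K_data g).
Proof. by rewrite -c_cosetsE -(orbit_mapE c_cosets_equivariant). Qed.

End RigidCosets.

(* Main.v *)
Require Import Defs.
From mathcomp Require Import all_boot.
From mathcomp Require Import boolp classical_sets.

(** The smallest realizable kernel containing a normal subgroup [N] of
    [G = Inn(X)] is the kernel of [G -> Inn(X/N)]
    ([realizable_hull_kernel]): if a homomorphism [h] out of [X] has [N] in
    its kernel, then [h] is constant on [N]-orbits, so an element of [G] that
    preserves every [N]-orbit lies in the kernel of [h] too.

    A [G]-equivariant surjection [X -> Y] with [G = Inn(X) = Inn(Y)] therefore
    gives a commutative triangle of surjections from [G] to [Inn(X/N)] and
    [Inn(Y/N)], whose legs have kernels [N^X] and [N^Y] and whose third side is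
    the map [Inn(X/N) -> Inn(Y/N)] induced by [X/N -> Y/N]
    ([Inn_map_orbit_map]).  This third side is injective exactly when
    [N^X = N^Y] ([orbit_map_rigidP]).  For [X = H\G] and [Y = K\G] the theorem
    follows, because [N^X = N] when [N] is a realizable kernel for [X]. *)

Local Open Scope classical_set_scope.
Local Open Scope group_scope.

(** [Inn_map h] is always onto, so rigidity only concerns its kernel. *)
Lemma rigid_quotientP {Q R : quandleType} (h : epi Q R) :
  rigid_quotient h <-> (forall g, Inn_map h g = 1 -> g = 1).
Proof.
split=> [h_rigid g g1|ker1].
  by apply: (bij_inj h_rigid); rewrite g1 Inn_map1.
have inj_h : injective (Inn_map h).
  move=> f g fg; apply: (mulIg g^-1); rewrite mulgV; apply: ker1.
  by rewrite Inn_mapM Inn_mapV fg mulgV.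
have [s sK] := choice (Inn_map_surj h).
by exists s => // g; apply: inj_h; rewrite sK.
Qed.

(** An element acting trivially on [X/N] moves each [x] to some [gact i x n]
    with [n] in [N], and no homomorphism whose kernel contains [N] can tell
    these two points apart. *)
Lemma realizable_hull_kernel {G : groupType} {X : quandleType}
    (i : innIso G X) (N : normal_subgroup G) :
  realizable_hull i N = [set g | Inn_map (orbits_epi i N) (i g) = 1].
Proof.
apply/seteqP; split.
  apply: realizable_hull_min; first by exists (orbits i N), (orbits_epi i N).
  move=> n Nn /=; apply: Inn_map_uniq => x; rewrite act1; apply: sval_inj.
  exact/esym/(@Norbit_eq _ _ i N).
move=> g /= g1 _ [[Y [h ->]] NM] /=.
apply: Inn_map_uniq => x; rewrite act1 -/(gact i x g).
have : cls i N (gact i x g) = cls i N x.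
  by have := Inn_mapE (orbits_epi i N) (i g) x; rewrite g1 act1.
move=> /(congr1 sval) /= xgx.
have [n Nn <-] : Norbit i N x (gact i x g) by rewrite -xgx; exact: Norbit_id.
by rewrite -Inn_mapE (NM n Nn).
Qed.

Lemma realizable_hull_id {G : groupType} {X : quandleType}
    (i : innIso G X) (N : set G) :
  realizable_kernel i N -> realizable_hull i N = N.
Proof.
move=> N_real; apply/seteqP; split; last exact: realizable_hull_sub.
exact: realizable_hull_min.
Qed.

Section OrbitMapRigid.
Context {G : groupType} {X Y : quandleType}.
Context {i : innIso G X} {j : innIso G Y} {h : epi X Y}.
Context (h_eq : forall x g, h (gact i x g) = gact j (h x) g).
Context (N : normal_subgroup G).

Lemma Inn_map_orbit_map g :
  Inn_map (orbit_map h_eq N) (Inn_map (orbits_epi i N) (i g)) =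
  Inn_map (orbits_epi j N) (j g).
Proof.
have orbitE x : orbits_epi j N (h x) = orbit_map h_eq N (orbits_epi i N x).
  exact/esym/orbit_mapE.
apply/esym/Inn_map_uniq => y; have [x <-] := epi_surj h y.
by rewrite orbitE !Inn_mapE -orbitE -/(gact i x g) h_eq.
Qed.

Lemma orbit_map_rigidP :
  rigid_quotient (orbit_map h_eq N) <->
  realizable_hull i N = realizable_hull j N.
Proof.
rewrite !realizable_hull_kernel rigid_quotientP; split=> [ker1|ker_eq f f1].
  apply/seteqP; split=> g /= g1.
    by rewrite -Inn_map_orbit_map g1 Inn_map1.
  by apply: ker1; rewrite Inn_map_orbit_map.
have [a af] := Inn_map_surj (orbits_epi i N) f.
have [i' _ i'K] := iso_bij i; rewrite -(i'K a) in af.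
have /seteqP[_ /(_ (i' a)) /=] := ker_eq.
by rewrite -Inn_map_orbit_map af; apply.
Qed.

End OrbitMapRigid.

Theorem theorem3p6 (Q R : quandleType) (connQ : connected Q)
    (c : epi Q R) (c_rigid : rigid_quotient c) (q : Q)
    (N : normal_subgroup (Inn Q))
    (N_real : realizable_kernel (H_iso connQ q) N) :
  rigid_quotient (c_orbits connQ c_rigid q N) <->
  nsub N = realizable_hull (K_iso connQ c_rigid q) N.
Proof.
rewrite -[X in _ <-> X = _](realizable_hull_id _ _ N_real).
exact: orbit_map_rigidP.
Qed.
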